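(* Let $G = \mathrm{Homeo}^+[0,1]$ and let $\mathfrak{M}$ be the complete $G$-space defined below. Then for every minimal complete $G$-space $X$ with more than one point there is a $G$-equivariant bijection $\mathfrak{M} \to X$ which is uniformly continuous with uniformly continuous inverse. Consequently, every complete $G$-space on which $G$ acts transitively is a singleton.
   Context: $G = \mathrm{Homeo}^+[0,1]$ is the group of increasing homeomorphisms of $[0,1]$ with the topology of uniform convergence. $\mathfrak{M}$ is the set of all continuous, weakly increasing, surjective maps $\xi\colon[0,1]\to[0,1]$, with metric $d(\xi,\zeta)=\|\xi-\zeta\|_\infty$ and action $g\cdot\xi = \xi\circ g^{-1}$. A complete $G$-space is a nonempty complete metric space with a jointly continuous action of $G$ by isometries; it is minimal if every $G$-orbit is dense. *)

(* Defs.v *)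
From Stdlib Require Import Reals Lra.
Open Scope R_scope.

Definition I : Type := {t : R | 0 <= t <= 1}.
Definition ival (t : I) : R := proj1_sig t.

Definition cont_I (f : I -> I) : Prop :=
  forall t eps, 0 < eps -> exists delta, 0 < delta /\
    forall s, Rabs (ival s - ival t) < delta -> Rabs (ival (f s) - ival (f t)) < eps.

Record G : Type := mkG {
  gf : I -> I;
  ginv : I -> I;
  g_left : forall t, ginv (gf t) = t;
  g_right : forall t, gf (ginv t) = t;
  g_cont : cont_I gf;
  ginv_cont : cont_I ginv;
  g_incr : forall s t, ival s < ival t -> ival (gf s) < ival (gf t)
}.

Definition Gclose (g h : G) (delta : R) : Prop :=
  forall t, Rabs (ival (gf g t) - ival (gf h t)) <= delta.

Record M : Type := mkM {
  xi : I -> I;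
  xi_cont : cont_I xi;
  xi_mono : forall s t, ival s <= ival t -> ival (xi s) <= ival (xi t);
  xi_surj : forall u, exists t, xi t = u
}.

Definition Mclose (a b : M) (delta : R) : Prop :=
  forall t, Rabs (ival (xi a t) - ival (xi b t)) <= delta.

Definition Mact_rel (g : G) (a b : M) : Prop :=
  forall t, xi b t = xi a (ginv g t).

Definition is_metric {X : Type} (d : X -> X -> R) : Prop :=
  (forall x y, 0 <= d x y) /\
  (forall x y, d x y = 0 <-> x = y) /\
  (forall x y, d x y = d y x) /\
  (forall x y z, d x z <= d x y + d y z).

Definition complete {X : Type} (d : X -> X -> R) : Prop :=
  forall u : nat -> X,
    (forall eps, 0 < eps -> exists N, forall m n, (N <= m)%nat -> (N <= n)%nat ->
        d (u m) (u n) < eps) ->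
    exists l, forall eps, 0 < eps -> exists N, forall n, (N <= n)%nat -> d (u n) l < eps.

Definition G_space {X : Type} (d : X -> X -> R) (act : G -> X -> X) : Prop :=
  inhabited X /\ is_metric d /\ complete d /\
  (forall g x y, d (act g x) (act g y) = d x y) /\
  (forall e x, (forall t, gf e t = t) -> act e x = x) /\
  (forall g h k x, (forall t, gf k t = gf g (gf h t)) -> act k x = act g (act h x)) /\
  (forall g x eps, 0 < eps -> exists delta, 0 < delta /\
     forall h y, Gclose h g delta -> d y x < delta -> d (act h y) (act g x) < eps).

Definition minimal {X : Type} (d : X -> X -> R) (act : G -> X -> X) : Prop :=
  forall x y eps, 0 < eps -> exists g, d (act g x) y < eps.

Definition transitive {X : Type} (act : G -> X -> X) : Prop :=
  forall x y, exists g, act g x = y.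

(* Main.v *)
Require Import Defs.
From Stdlib Require Import Reals ZArith Lra Lia Cantor Classical ClassicalEpsilon.
From Stdlib Require Import ProofIrrelevance FunctionalExtensionality.
Open Scope R_scope.

(** Write [x . g] for [g^-1 x].  The map [g |-> x . g] is uniformly continuous for
    the uniform distance on [G], and [G] is dense in the complete space [M], so it extends
    to [M].  The point is to choose [x] so that the extension is a uniform isomorphism.

    Say that [x] is locally fixed on [(p, q)] if all homeomorphisms supported there
    fix [x].  If elements [g] with [g p >= q] move [x] arbitrarily little, then [x] is
    locally fixed on [(p, q)]: among [N] powers of [g], one squeezes [(p, q)] to length
    at most [1/N], so it conjugates [h] supported in [(p, q)] to an almost trivial
    element.  Hence if [x] is locally fixed nowhere, [d(gx, x)] small forces [g] to be
    uniformly close to the identity, as wanted.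

    Such an [x] exists by Baire.  Suppose a whole ball around [y] is locally fixed on
    [(p, q)].  If [y] is locally fixed on [(a, b)], stretch [(p, q)] to almost [(a, b)]
    by some [u] supported in [(a, b)], and then past [(a, b)] by some [v] close to the
    identity; [(vu)^-1 y] stays in the ball, so [y] is locally fixed on [vu(p, q)].
    Iterating, [y] is fixed by all of [G], which minimality excludes.

    Finally [M] itself is not homogeneous: [G] is a proper invariant subset. *)

#[local] Coercion ival : I >-> R.

(** * The unit interval *)

Lemma ival_inj (s t : I) : ival s = ival t -> s = t.
Proof.
  destruct s as [s Hs], t as [t Ht]; simpl; intros <-.
  f_equal; apply proof_irrelevance.
Qed.

Lemma ival_bounds (t : I) : 0 <= t <= 1.
Proof. exact (proj2_sig t). Qed.

Lemma clamp_bounds (r : R) : 0 <= Rmax 0 (Rmin 1 r) <= 1.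
Proof. unfold Rmin; destruct (Rle_dec 1 r); unfold Rmax; destruct Rle_dec; lra. Qed.

(** A total retraction of the line onto the interval, so that real formulas define maps of [I]
    without carrying bound proofs. *)
Definition clamp (r : R) : I := exist _ _ (clamp_bounds r).

Lemma clamp_cases (r : R) :
  (r <= 0 /\ ival (clamp r) = 0) \/ (1 <= r /\ ival (clamp r) = 1) \/
  (0 <= r <= 1 /\ ival (clamp r) = r).
Proof.
  simpl. unfold Rmin; destruct (Rle_dec 1 r); unfold Rmax; destruct Rle_dec; lra.
Qed.

Lemma clampE (r : R) : 0 <= r <= 1 -> ival (clamp r) = r.
Proof. pose proof (clamp_cases r); lra. Qed.

Lemma clamp_ival (t : I) : clamp t = t.
Proof. apply ival_inj, clampE, ival_bounds. Qed.

Lemma clamp_lipschitz (r s : R) : Rabs (clamp r - clamp s) <= Rabs (r - s).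
Proof.
  pose proof (clamp_cases r); pose proof (clamp_cases s).
  unfold Rabs; repeat destruct Rcase_abs; lra.
Qed.

Lemma Rabs_le_inv (x r : R) : Rabs x <= r -> - r <= x <= r.
Proof. unfold Rabs; destruct Rcase_abs; lra. Qed.

Lemma nat_floor (x : R) : 0 <= x -> exists n : nat, INR n <= x < INR n + 1.
Proof.
  intros Hx. destruct (archimed x) as [H1 H2].
  assert (Hz : (0 < up x)%Z) by (apply lt_IZR; lra).
  exists (Z.to_nat (up x - 1)). rewrite INR_IZR_INZ, Z2Nat.id, minus_IZR by lia. lra.
Qed.

Lemma inv_INR_small (eps : R) :
  0 < eps -> exists N : nat, 0 < / INR (S N) /\ / INR (S N) < eps.
Proof.
  intros He. destruct (archimed_cor1 eps He) as [N [H1 H2]].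
  destruct N as [|N]; [lia|]. exists N. split; [|exact H1].
  apply Rinv_0_lt_compat, lt_0_INR. lia.
Qed.

(** Makes the family of intervals in the Baire argument countable. The numerator [S i] keeps the
    left end positive. *)
Lemma rational_between (p q : R) :
  0 <= p -> p < q -> exists i j : nat,
    p <= INR (S i) / INR (S j) /\ INR (S (S i)) / INR (S j) < q.
Proof.
  (* With spacing below a third of [q - p], the first grid interval starting after [p] ends before
     [q]. *)
  intros Hp Hpq. destruct (inv_INR_small ((q - p) / 3)) as [j [J0 J1]]; [lra|].
  assert (HS : 0 < INR (S j)) by (apply lt_0_INR; lia).
  destruct (nat_floor (p * INR (S j))) as [i [I0 I1]]; [nra|].
  exists i, j. unfold Rdiv. rewrite !(S_INR (S i)), !(S_INR i).
  set (e := / INR (S j)) in *.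
  assert (Ee : INR (S j) * e = 1) by (unfold e; field; lra).
  split.
  - apply Rle_trans with (p * INR (S j) * e); [rewrite Rmult_assoc, Ee; lra|].
    apply Rmult_le_compat_r; lra.
  - assert (INR i * e <= p).
    { apply Rle_trans with (p * INR (S j) * e); [|rewrite Rmult_assoc, Ee; lra].
      apply Rmult_le_compat_r; lra. }
    nra.
Qed.

(** A jump of a monotone map would leave a gap in its image. Preimages of [f t - eps / 2] and
    [f t + eps / 2], clamped, bound a suitable neighbourhood of [t]. *)
Lemma cont_incr_surj (f : I -> I) :
  (forall s t, ival s < ival t -> ival (f s) < ival (f t)) ->
  (forall u, exists t, f t = u) -> cont_I f.
Proof.
  intros Hi Hs t eps He.
  assert (Hle : forall s s' : I, s <= s' -> f s <= f s').
  { intros s s' [H|H]; [left; auto|]. apply ival_inj in H; subst; lra. }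
  assert (Hlo : exists d1, 0 < d1 /\ forall s : I, t - s < d1 -> f t - f s < eps).
  { destruct (Hs (clamp (f t - eps / 2))) as [s1 E1].
    assert (V1 : ival (f s1) = clamp (f t - eps / 2)) by now rewrite E1.
    pose proof (clamp_cases (f t - eps / 2)) as C1; rewrite <- V1 in C1.
    destruct (Rlt_dec s1 t) as [H|H].
    - exists (t - s1). split; [lra|]. intros s Hst.
      assert (f s1 <= f s) by (apply Hle; lra).
      pose proof (ival_bounds (f t)); lra.
    (* This case forces [f t] to be 0, so any radius will do. *)
    - exists 1. split; [lra|]. intros s _.
      assert (f t <= f s1) by (apply Hle; lra).
      pose proof (ival_bounds (f s)); pose proof (ival_bounds (f t)); lra. }
  assert (Hhi : exists d2, 0 < d2 /\ forall s : I, s - t < d2 -> f s - f t < eps).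
  { destruct (Hs (clamp (f t + eps / 2))) as [s1 E1].
    assert (V1 : ival (f s1) = clamp (f t + eps / 2)) by now rewrite E1.
    pose proof (clamp_cases (f t + eps / 2)) as C1; rewrite <- V1 in C1.
    destruct (Rlt_dec t s1) as [H|H].
    - exists (s1 - t). split; [lra|]. intros s Hst.
      assert (f s <= f s1) by (apply Hle; lra).
      pose proof (ival_bounds (f t)); lra.
    - exists 1. split; [lra|]. intros s _.
      assert (f s1 <= f t) by (apply Hle; lra).
      pose proof (ival_bounds (f s)); pose proof (ival_bounds (f t)); lra. }
  destruct Hlo as [d1 [P1 Q1]], Hhi as [d2 [P2 Q2]].
  exists (Rmin d1 d2). split; [now apply Rmin_pos|].
  intros s Hst. apply Rabs_def2 in Hst.
  pose proof (Rmin_l d1 d2); pose proof (Rmin_r d1 d2).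
  apply Rabs_def1.
  - apply Q2; lra.
  - enough (f t - f s < eps) by lra. apply Q1; lra.
Qed.

(** The intermediate value theorem for [f - u], extended to the whole line through [clamp]. *)
Lemma surj_of_cont (f : I -> I) :
  cont_I f -> f (clamp 0) = clamp 0 -> f (clamp 1) = clamp 1 ->
  forall u, exists t, f t = u.
Proof.
  intros Hc H0 H1 u. pose proof (ival_bounds u) as Hu.
  destruct (IVT_cor (fun r => f (clamp r) - u) 0 1) as [z [Hz Ez]].
  - intros r eps He. destruct (Hc (clamp r) eps He) as [dl [Hd H]].
    exists dl. split; [exact Hd|]. intros s [_ Hs]. simpl in *. unfold Rdist in *.
    replace (f (clamp s) - u - (f (clamp r) - u)) with (f (clamp s) - f (clamp r)) by ring.
    apply H. eapply Rle_lt_trans; [apply clamp_lipschitz|exact Hs].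
  - lra.
  - rewrite H0, H1, !clampE by lra. nra.
  - exists (clamp z). apply ival_inj. lra.
Qed.

(** * The homeomorphism group *)

(** Turns a formula into a homeomorphism: the inverse comes from choice and is again increasing and
    surjective, so [cont_incr_surj] applies to both maps. *)
Lemma homeo_of_incr_surj (f : I -> I) :
  (forall s t, ival s < ival t -> ival (f s) < ival (f t)) ->
  (forall u, exists t, f t = u) -> exists g : G, forall t, gf g t = f t.
Proof.
  intros Hi Hs.
  destruct (choice (fun u t => f t = u) Hs) as [k Hk].
  assert (Hle : forall s t : I, f s < f t -> s < t).
  { intros s t H. destruct (Rlt_le_dec s t) as [L|[L|L]]; auto.
    - apply Hi in L; lra.
    - apply ival_inj in L; subst; lra. }
  assert (Hl : forall t, k (f t) = t).
  { intros t. apply ival_inj.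
    destruct (Rtotal_order (k (f t)) t) as [L|[L|L]]; auto;
      apply Hi in L; rewrite Hk in L; lra. }
  assert (Hki : forall s t, ival s < ival t -> ival (k s) < ival (k t)).
  { intros s t H. apply Hle. now rewrite !Hk. }
  unshelve eexists.
  - refine (@mkG f k Hl Hk _ _ Hi).
    + now apply cont_incr_surj.
    + apply cont_incr_surj; auto. intros u; exists (f u); auto.
  - reflexivity.
Qed.

Lemma gf_le (g : G) (s t : I) : s <= t -> gf g s <= gf g t.
Proof.
  intros [H|H]; [left; now apply g_incr|]. apply ival_inj in H; subst; lra.
Qed.

Lemma gf_lt_inv (g : G) (s t : I) : gf g s < gf g t -> s < t.
Proof. intros H. destruct (Rlt_le_dec s t) as [L|L]; auto. apply (gf_le g) in L; lra. Qed.

Lemma ginv_incr (g : G) (s t : I) : ival s < ival t -> ival (ginv g s) < ival (ginv g t).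
Proof. intros H. apply (gf_lt_inv g). now rewrite !g_right. Qed.

Definition Gid : G.
Proof.
  refine (@mkG (fun t => t) (fun t => t) _ _ _ _ _); auto;
    intros t eps He; exists eps; auto.
Defined.

Definition Ginv (g : G) : G :=
  @mkG (ginv g) (gf g) (g_right g) (g_left g) (ginv_cont g) (g_cont g) (ginv_incr g).

Lemma cont_comp (f k : I -> I) : cont_I f -> cont_I k -> cont_I (fun t => f (k t)).
Proof.
  intros Hf Hk t eps He. destruct (Hf (k t) eps He) as [d1 [P1 Q1]].
  destruct (Hk t d1 P1) as [d2 [P2 Q2]]. exists d2. split; auto.
Qed.

Definition Gmul (g h : G) : G.
Proof.
  refine (@mkG (fun t => gf g (gf h t)) (fun t => ginv h (ginv g t)) _ _ _ _ _).
  - intros t. now rewrite !g_left.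
  - intros t. now rewrite !g_right.
  - apply (cont_comp (gf g) (gf h)); apply g_cont.
  - apply (cont_comp (ginv h) (ginv g)); apply ginv_cont.
  - intros s t H. now do 2 apply g_incr.
Defined.

Fixpoint Gpow (g : G) (n : nat) : G :=
  match n with O => Gid | S k => Gmul g (Gpow g k) end.

Lemma gf_zero (g : G) : gf g (clamp 0) = clamp 0.
Proof.
  apply ival_inj. rewrite (clampE 0) by lra.
  pose proof (ival_bounds (gf g (clamp 0))).
  enough (gf g (clamp 0) <= gf g (ginv g (clamp 0))) by (rewrite g_right, clampE in *; lra).
  apply gf_le. rewrite clampE by lra. apply ival_bounds.
Qed.

Lemma gf_one (g : G) : gf g (clamp 1) = clamp 1.
Proof.
  apply ival_inj. rewrite (clampE 1) by lra.
  pose proof (ival_bounds (gf g (clamp 1))).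
  enough (gf g (ginv g (clamp 1)) <= gf g (clamp 1)) by (rewrite g_right, clampE in *; lra).
  apply gf_le. rewrite clampE by lra. apply ival_bounds.
Qed.

(** * Supports, bumps and wandering intervals *)

Definition supported (h : G) (p q : R) : Prop :=
  forall t : I, t <= p \/ q <= t -> gf h t = t.

Lemma supported_mono (h : G) (p q p' q' : R) :
  p' <= p -> q <= q' -> supported h p q -> supported h p' q'.
Proof. intros Hp Hq Hs t Ht. apply Hs. destruct Ht; [left|right]; lra. Qed.

Lemma supported_mul (g h : G) (p q : R) :
  supported g p q -> supported h p q -> supported (Gmul g h) p q.
Proof. intros Hg Hh t Ht. simpl. rewrite (Hh t Ht). auto. Qed.

Lemma supported_inside (h : G) (p q : I) :
  supported h p q -> forall t : I, p <= t <= q -> p <= gf h t <= q.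
Proof.
  intros Hs t [H1 H2]. apply (gf_le h) in H1, H2.
  rewrite (Hs p) in H1 by lra. rewrite (Hs q) in H2 by lra. lra.
Qed.

Lemma supported_conj (w h : G) (p q : I) :
  supported h (gf w p) (gf w q) -> supported (Gmul (Ginv w) (Gmul h w)) p q.
Proof.
  intros Hs t Ht. simpl. rewrite Hs; [apply g_left|].
  destruct Ht as [Ht|Ht]; [left|right]; now apply gf_le.
Qed.

(** A piecewise linear map with slope [k1] on [[a, s]] and [k2] on [[s, b]]. Its displacement
    vanishes at [a] and [b] and is largest at [s]. *)
Lemma bump_exists (a b s s' : R) :
  0 <= a -> b <= 1 -> a < s < b -> a < s' < b ->
  exists g : G, supported g a b /\ gf g (clamp s) = clamp s' /\
    forall t, Rabs (gf g t - ival t) <= Rabs (s' - s).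
Proof.
  intros Ha Hb Hs Hs'.
  set (k1 := (s' - a) / (s - a)). set (k2 := (b - s') / (b - s)).
  assert (E1 : k1 * (s - a) = s' - a) by (unfold k1; field; lra).
  assert (E2 : k2 * (b - s) = b - s') by (unfold k2; field; lra).
  assert (P1 : 0 < k1) by (apply Rdiv_lt_0_compat; lra).
  assert (P2 : 0 < k2) by (apply Rdiv_lt_0_compat; lra).
  set (F := fun t : R => if Rle_dec t a then t else if Rle_dec t s then a + k1 * (t - a)
                  else if Rle_dec t b then b - k2 * (b - t) else t).
  assert (FI : forall t u : R, t < u -> F t < F u).
  { intros t u H. unfold F; repeat destruct Rle_dec; try lra; nra. }
  assert (FB : forall t, 0 <= t <= 1 -> 0 <= F t <= 1).
  { intros t H. unfold F; repeat destruct Rle_dec; try lra; nra. }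
  assert (FD : forall t, Rabs (F t - t) <= Rabs (s' - s)).
  { intros t. unfold F; repeat destruct Rle_dec;
      try (rewrite Rminus_diag, Rabs_R0; apply Rabs_pos).
    - replace (a + k1 * (t - a) - t) with ((s' - s) * ((t - a) / (s - a)))
        by (unfold k1; field; lra).
      rewrite Rabs_mult. rewrite <- (Rmult_1_r (Rabs (s' - s))) at 2.
      apply Rmult_le_compat_l; [apply Rabs_pos|].
      assert (Q : (t - a) / (s - a) * (s - a) = t - a) by (field; lra).
      apply Rabs_le; nra.
    - replace (b - k2 * (b - t) - t) with ((s' - s) * ((b - t) / (b - s)))
        by (unfold k2; field; lra).
      rewrite Rabs_mult. rewrite <- (Rmult_1_r (Rabs (s' - s))) at 2.
      apply Rmult_le_compat_l; [apply Rabs_pos|].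
      assert (Q : (b - t) / (b - s) * (b - s) = b - t) by (field; lra).
      apply Rabs_le; nra. }
  assert (Fval : forall t : I, ival (clamp (F t)) = F t).
  { intros t. apply clampE, FB, ival_bounds. }
  destruct (homeo_of_incr_surj (fun t : I => clamp (F t))) as [g Hg].
  - intros t u H. rewrite !Fval. auto.
  - intros u. pose proof (ival_bounds u) as Hu.
    assert (HF : exists t : R, 0 <= t <= 1 /\ F t = u).
    { destruct (Rle_dec u a); [|destruct (Rle_dec u s'); [|destruct (Rle_dec u b)]].
      - exists u. split; [lra|]. unfold F; repeat destruct Rle_dec; lra.
      - exists (a + (u - a) / k1).
        assert (Q : (u - a) / k1 * k1 = u - a) by (field; lra).
        assert (0 < (u - a) / k1 <= s - a) by (split; nra).
        split; [lra|]. unfold F; repeat destruct Rle_dec; nra.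
      - exists (b - (b - u) / k2).
        assert (Q : (b - u) / k2 * k2 = b - u) by (field; lra).
        assert (0 <= (b - u) / k2 < b - s) by (split; nra).
        split; [lra|]. unfold F; repeat destruct Rle_dec; nra.
      - exists u. split; [lra|]. unfold F; repeat destruct Rle_dec; lra. }
    destruct HF as [t [Ht E]]. exists (clamp t). rewrite (clampE t Ht), E.
    apply clamp_ival.
  - exists g. repeat split.
    + intros t Ht. rewrite Hg. apply ival_inj. rewrite Fval.
      unfold F; repeat destruct Rle_dec; try lra.
      replace (ival t) with b by lra. ring.
    + rewrite Hg, clampE by lra. f_equal. unfold F; repeat destruct Rle_dec; lra.
    + intros t. rewrite Hg, Fval. apply FD.
Qed.

(** Fixing both endpoints, [h] preserves the interval between them and can be replaced by the
    identity outside. *)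
Lemma restriction_exists (h : G) (a b : I) :
  a < b -> gf h a = a -> gf h b = b ->
  exists k : G, supported k a b /\ forall t : I, a <= t <= b -> gf k t = gf h t.
Proof.
  intros Hab Ha Hb.
  assert (HI : forall t : I, a <= t <= b -> a <= gf h t <= b).
  { intros t [H1 H2]. apply (gf_le h) in H1, H2. rewrite Ha in H1. rewrite Hb in H2. lra. }
  set (f := fun t : I => if Rle_dec a t then if Rle_dec t b then gf h t else t else t).
  destruct (homeo_of_incr_surj f) as [k Hk].
  - intros s t H. pose proof (HI s); pose proof (HI t); pose proof (g_incr h s t H).
    unfold f; repeat destruct Rle_dec; lra.
  - intros u. destruct (classic (a <= u <= b)) as [Hu|Hu].
    + exists (ginv h u). unfold f.
      assert (a <= ginv h u <= b).
      { split; apply Rnot_lt_le; intros L; apply (g_incr h) in L;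
          rewrite g_right, ?Ha, ?Hb in L; lra. }
      repeat destruct Rle_dec; try lra. apply g_right.
    + exists u. unfold f; repeat destruct Rle_dec; try lra; reflexivity.
  - exists k. split.
    + intros t Ht. rewrite Hk. apply ival_inj. unfold f; repeat destruct Rle_dec; try lra.
      destruct Ht as [Ht|Ht].
      * assert (t = a) by (apply ival_inj; lra). subst; now rewrite Ha.
      * assert (t = b) by (apply ival_inj; lra). subst; now rewrite Hb.
    + intros t Ht. rewrite Hk. unfold f; repeat destruct Rle_dec; try lra; reflexivity.
Qed.

(* If [g p >= q], the translates of [(p, q)] by the powers of [g] are pairwise disjoint. *)
Lemma wandering_interval (g : G) (p q : I) (N : nat) :
  q <= gf g p -> (0 < N)%nat ->
  exists k, (k < N)%nat /\ gf (Gpow g k) q - gf (Gpow g k) p <= / INR N.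
Proof.
  intros Hg HN. apply NNPP. intros Hno.
  assert (Hbig : forall k, (k < N)%nat -> / INR N < gf (Gpow g k) q - gf (Gpow g k) p).
  { intros k Hk. apply Rnot_le_lt. intros L. apply Hno. eauto. }
  assert (Hcomm : forall k t, gf g (gf (Gpow g k) t) = gf (Gpow g k) (gf g t)).
  { induction k as [|k IH]; intros t; simpl; [reflexivity|]. now rewrite IH. }
  (* Each step gains more than [1/N], since [g^(n+1) p >= g^n q]. After the last step [q] would be
     carried beyond 1. *)
  assert (Hsum : forall n, (n <= N)%nat -> INR n * / INR N <= gf (Gpow g n) p).
  { induction n as [|n IH]; intros Hn.
    - simpl. pose proof (ival_bounds p). lra.
    - rewrite S_INR. simpl Gpow. simpl gf. rewrite Hcomm.
      apply (gf_le (Gpow g n)) in Hg.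
      specialize (IH ltac:(lia)). specialize (Hbig n ltac:(lia)). lra. }
  destruct N as [|N]; [lia|].
  assert (HN0 : 0 < INR (S N)) by (apply lt_0_INR; lia).
  pose proof (Hsum N ltac:(lia)). pose proof (Hbig N ltac:(lia)).
  pose proof (ival_bounds (gf (Gpow g N) q)).
  assert ((INR N + 1) * / INR (S N) = 1) by (rewrite <- S_INR; field; lra). lra.
Qed.

(** * The space of monotone surjections *)

Lemma xi_zero (a : M) : xi a (clamp 0) = clamp 0.
Proof.
  destruct (xi_surj a (clamp 0)) as [t Ht]. apply ival_inj.
  pose proof (ival_bounds (xi a (clamp 0))). pose proof (ival_bounds t).
  pose proof (xi_mono a (clamp 0) t) as L. rewrite Ht, !clampE in * by lra.
  specialize (L ltac:(lra)). lra.
Qed.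

Lemma xi_one (a : M) : xi a (clamp 1) = clamp 1.
Proof.
  destruct (xi_surj a (clamp 1)) as [t Ht]. apply ival_inj.
  pose proof (ival_bounds (xi a (clamp 1))). pose proof (ival_bounds t).
  pose proof (xi_mono a t (clamp 1)) as L. rewrite Ht, !clampE in * by lra.
  specialize (L ltac:(lra)). lra.
Qed.

(** Mixing in a small multiple [e] of the identity makes the map strictly increasing and changes it
    by at most [e]. *)
Lemma G_dense_M (a : M) (eps : R) :
  0 < eps -> exists g : G, forall t, Rabs (gf g t - xi a t) <= eps.
Proof.
  intros He. set (e := Rmin eps (/ 2)).
  assert (E0 : 0 < e) by (apply Rmin_pos; lra).
  assert (E1 : e <= eps) by apply Rmin_l. assert (E2 : e <= / 2) by apply Rmin_r.
  set (f := fun t : I => clamp ((1 - e) * xi a t + e * t)).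
  assert (Hf : forall t, ival (f t) = (1 - e) * xi a t + e * t).
  { intros t. apply clampE. pose proof (ival_bounds t). pose proof (ival_bounds (xi a t)).
    split; nra. }
  assert (Hc : cont_I f).
  { intros t r Hr. destruct (xi_cont a t r Hr) as [dl [Hd H]].
    exists (Rmin dl r). split; [now apply Rmin_pos|]. intros s Hs.
    pose proof (Rmin_l dl r). pose proof (Rmin_r dl r).
    specialize (H s ltac:(lra)). apply Rabs_def2 in Hs, H.
    rewrite !Hf. apply Rabs_def1; nra. }
  destruct (homeo_of_incr_surj f) as [g Hg].
  - intros s t H. rewrite !Hf. pose proof (xi_mono a s t ltac:(lra)). nra.
  - apply surj_of_cont; auto; apply ival_inj; rewrite Hf, ?xi_zero, ?xi_one, !clampE by lra; ring.
  - exists g. intros t. rewrite Hg, Hf.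
    pose proof (ival_bounds t). pose proof (ival_bounds (xi a t)).
    apply Rabs_le. split; nra.
Qed.

(** Strict monotonicity may be lost in the limit, but continuity, weak monotonicity and the values
    at the endpoints pass to it from uniform approximants in [G]. *)
Lemma M_complete (u : nat -> G) :
  (forall eps, 0 < eps -> exists N, forall m n, (N <= m)%nat -> (N <= n)%nat ->
     Gclose (u m) (u n) eps) ->
  exists a : M, forall eps, 0 < eps -> exists N, forall n, (N <= n)%nat ->
     forall t, Rabs (gf (u n) t - xi a t) <= eps.
Proof.
  intros Hu.
  assert (Hlim : forall t, exists l : R, Un_cv (fun n => gf (u n) t) l).
  { intros t. destruct (R_complete (fun n => gf (u n) t)) as [l Hl]; [|eauto].
    intros eps He. destruct (Hu (eps / 2)) as [N HN]; [lra|].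
    exists N. intros n m Hn Hm. specialize (HN n m Hn Hm t). unfold Rdist. lra. }
  destruct (choice _ Hlim) as [L HL].
  assert (Hunif : forall eps, 0 < eps -> exists N, forall n, (N <= n)%nat ->
     forall t, Rabs (gf (u n) t - L t) <= eps).
  { intros eps He. destruct (Hu (eps / 2)) as [N HN]; [lra|].
    exists N. intros n Hn t. destruct (HL t (eps / 2)) as [N' HN']; [lra|].
    set (m := (N + N')%nat).
    specialize (HN n m Hn ltac:(lia) t). specialize (HN' m ltac:(lia)).
    unfold Rdist in HN'. apply Rabs_le. apply Rabs_le_inv in HN. apply Rabs_def2 in HN'. lra. }
  assert (Happ : forall eps, 0 < eps -> exists g : G, forall t, Rabs (gf g t - L t) <= eps).
  { intros eps He. destruct (Hunif eps He) as [N HN]. exists (u N). now apply HN. }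
  assert (HB : forall t, 0 <= L t <= 1).
  { intros t. split; apply Rle_plus_epsilon; intros eps He;
      destruct (Happ eps He) as [g Hg]; specialize (Hg t); apply Rabs_le_inv in Hg;
      pose proof (ival_bounds (gf g t)); lra. }
  assert (Hval : forall t, ival (clamp (L t)) = L t) by (intros t; now apply clampE).
  set (f := fun t => clamp (L t)).
  assert (Hc : cont_I f).
  { intros t eps He. destruct (Happ (eps / 4)) as [g Hg]; [lra|].
    destruct (g_cont g t (eps / 4)) as [dl [Hd H]]; [lra|].
    exists dl. split; auto. intros s Hs. specialize (H s Hs).
    pose proof (Hg s) as Gs. pose proof (Hg t) as Gt.
    unfold f. rewrite !Hval. apply Rabs_def2 in H. apply Rabs_le_inv in Gs, Gt.
    apply Rabs_def1; lra. }
  assert (Hm : forall s t, ival s <= ival t -> ival (f s) <= ival (f t)).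
  { intros s t Hst. unfold f. rewrite !Hval. apply Rle_plus_epsilon. intros eps He.
    destruct (Happ (eps / 2)) as [g Hg]; [lra|]. pose proof (Hg s) as Gs. pose proof (Hg t) as Gt.
    apply Rabs_le_inv in Gs, Gt. pose proof (gf_le g s t Hst). lra. }
  (* Points fixed by every homeomorphism are fixed by the limit. For 0 and 1 this gives
     surjectivity. *)
  assert (Hend : forall s : I, (forall g, gf g s = s) -> f s = s).
  { intros s Hs. apply ival_inj. unfold f. rewrite Hval.
    apply Rle_antisym; apply Rle_plus_epsilon; intros eps He;
      destruct (Happ eps He) as [g Hg]; specialize (Hg s); rewrite Hs in Hg;
      apply Rabs_le_inv in Hg; lra. }
  assert (Hs : forall v, exists t, f t = v).
  { apply surj_of_cont; auto; apply Hend; intros g; [apply gf_zero|apply gf_one]. }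
  exists (@mkM f Hc Hm Hs). intros eps He. destruct (Hunif eps He) as [N HN].
  exists N. intros n Hn t. change (Rabs (gf (u n) t - clamp (L t)) <= eps).
  rewrite Hval. now apply HN.
Qed.

Lemma M_ext (a b : M) : (forall t, xi a t = xi b t) -> a = b.
Proof.
  destruct a as [f fc fm fs], b as [k kc km ks]; simpl. intros E.
  apply functional_extensionality in E. subst k. f_equal; apply proof_irrelevance.
Qed.

(** The image is the orbit of the identity map: [M_of_G (Ginv g)] is the translate of [M_of_G Gid]
    by [g]. *)
Definition M_of_G (g : G) : M :=
  @mkM (gf g) (g_cont g) (gf_le g) (fun u => ex_intro _ (ginv g u) (g_right g u)).

(** The map [min(2t, 1)] is constant on the right half of the interval. It therefore lies outside
    the orbit of the identity map. *)
Lemma noninjective_M : exists (a : M) (s t : I), s <> t /\ xi a s = xi a t.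
Proof.
  set (f := fun t : I => clamp (2 * t)).
  assert (Hc : cont_I f).
  { intros t eps He. exists (eps / 2). split; [lra|]. intros s Hs. unfold f.
    eapply Rle_lt_trans; [apply clamp_lipschitz|].
    apply Rabs_def2 in Hs. apply Rabs_def1; lra. }
  assert (Hm : forall s t, ival s <= ival t -> ival (f s) <= ival (f t)).
  { intros s t H. unfold f.
    pose proof (clamp_cases (2 * s)); pose proof (clamp_cases (2 * t)); lra. }
  assert (E1 : forall s : I, / 2 <= s -> f s = clamp 1).
  { intros s Hs. apply ival_inj. unfold f.
    pose proof (clamp_cases (2 * s)); pose proof (clamp_cases 1); lra. }
  assert (Hs : forall u, exists t, f t = u).
  { apply surj_of_cont; auto.
    - unfold f. rewrite clampE by lra. f_equal. ring.
    - apply E1. rewrite clampE; lra. }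
  exists (@mkM f Hc Hm Hs), (clamp (/ 2)), (clamp 1). split.
  - intros E. apply (f_equal ival) in E. rewrite !clampE in E; lra.
  - simpl. rewrite !E1; auto; rewrite clampE; lra.
Qed.

(** * Isometric actions *)

(** Nested closed balls with radii at least halving, the [n]-th step entering [O n]; the centres
    converge to a point of all the balls. *)
Lemma baire {X : Type} (d : X -> X -> R) (O : nat -> X -> Prop) :
  inhabited X -> is_metric d -> complete d ->
  (forall n x, O n x -> exists r, 0 < r /\ forall z, d z x < r -> O n z) ->
  (forall n y r, 0 < r -> exists z, d z y < r /\ O n z) ->
  exists x, forall n, O n x.
Proof.
  intros [x0] [_ [dist_eq0 [dist_sym dist_tri]]] Hcomp Hopen Hdense.
  assert (dist_refl : forall x, d x x = 0) by (intros x; now apply dist_eq0).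
  assert (Hstep : forall c : nat * (X * R), exists c' : X * R, 0 < snd (snd c) ->
    0 < snd c' <= snd (snd c) / 2 /\ d (fst c') (fst (snd c)) + snd c' <= snd (snd c) /\
    forall z, d z (fst c') <= snd c' -> O (fst c) z).
  { intros [n [y r]]. simpl. destruct (Rlt_le_dec 0 r) as [Hr|Hr].
    - destruct (Hdense n y (r / 2)) as [z [Hz Oz]]; [lra|].
      destruct (Hopen n z Oz) as [e [He Hb]].
      exists (z, Rmin (e / 2) (r / 2)). intros _. simpl.
      pose proof (Rmin_l (e / 2) (r / 2)). pose proof (Rmin_r (e / 2) (r / 2)).
      assert (0 < Rmin (e / 2) (r / 2)) by (apply Rmin_pos; lra).
      repeat split; try lra. intros z' Hz'. apply Hb. lra.
    (* A dummy value that makes the step total, as [choice] requires; actual radii stay positive. *)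
    - exists (y, r). intros; lra. }
  destruct (choice _ Hstep) as [F HF].
  set (c := fix c (n : nat) : X * R := match n with O => (x0, 1) | S k => F (k, c k) end).
  assert (Hpos : forall n, 0 < snd (c n)).
  { induction n as [|n IH]; [simpl; lra|]. destruct (HF (n, c n) IH) as [H _]. apply H. }
  assert (Hc : forall n, 0 < snd (c (S n)) <= snd (c n) / 2 /\
    d (fst (c (S n))) (fst (c n)) + snd (c (S n)) <= snd (c n) /\
    forall z, d z (fst (c (S n))) <= snd (c (S n)) -> O n z).
  { intros n. exact (HF (n, c n) (Hpos n)). }
  assert (Hnest : forall n k, d (fst (c (n + k)%nat)) (fst (c n)) + snd (c (n + k)%nat) <= snd (c n)).
  { intros n k. induction k as [|k IH].
    - rewrite Nat.add_0_r, dist_refl. lra.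
    - rewrite Nat.add_succ_r. destruct (Hc (n + k)%nat) as [_ [H _]].
      pose proof (dist_tri (fst (c (S (n + k)))) (fst (c (n + k)%nat)) (fst (c n))). lra. }
  assert (Hin : forall n k, (n <= k)%nat -> d (fst (c k)) (fst (c n)) <= snd (c n)).
  { intros n k Hk. replace k with (n + (k - n))%nat by lia.
    pose proof (Hnest n (k - n)%nat). pose proof (Hpos (n + (k - n))%nat). lra. }
  assert (Hrad : forall n, snd (c n) <= (/ 2) ^ n).
  { induction n as [|n IH]; [simpl; lra|]. destruct (Hc n) as [[_ H] _].
    change ((/ 2) ^ S n) with (/ 2 * (/ 2) ^ n). lra. }
  destruct (Hcomp (fun n => fst (c n))) as [l Hl].
  - intros eps He.
    destruct (pow_lt_1_zero (/ 2)) with (y := eps / 2) as [N HN];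
      [rewrite Rabs_pos_eq; lra | lra |].
    exists N. intros i j Hi Hj. specialize (HN N (le_n N)). apply Rabs_def2 in HN.
    pose proof (Hin N i Hi). pose proof (Hin N j Hj). pose proof (Hrad N).
    pose proof (dist_tri (fst (c i)) (fst (c N)) (fst (c j))) as T.
    rewrite (dist_sym (fst (c N))) in T. lra.
  - exists l. intros n. destruct (Hc n) as [_ [_ H]]. apply H.
    (* A limit outside the closed ball would keep a positive distance from it, whereas all later
       centres lie inside. *)
    apply Rnot_lt_le. intros L. set (x := fst (c (S n))) in *.
    destruct (Hl (d l x - snd (c (S n)))) as [N HN]; [lra|].
    set (k := (N + S n)%nat). specialize (HN k ltac:(lia)).
    pose proof (Hin (S n) k ltac:(lia)) as H1. fold x in H1.
    pose proof (dist_tri l (fst (c k)) x) as T. rewrite (dist_sym l (fst _)) in T. lra.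
Qed.

(** * Consequences of the axioms of a complete [G]-space *)

Section Action.

Context {X : Type} {d : X -> X -> R} {act : G -> X -> X} (HX : G_space d act).

Lemma dist_nonneg (x y : X) : 0 <= d x y.
Proof. apply HX. Qed.

Lemma dist_eq0 (x y : X) : d x y = 0 -> x = y.
Proof. apply HX. Qed.

Lemma dist_refl (x : X) : d x x = 0.
Proof. now apply HX. Qed.

Lemma dist_sym (x y : X) : d x y = d y x.
Proof. apply HX. Qed.

Lemma dist_tri (x y z : X) : d x z <= d x y + d y z.
Proof. apply HX. Qed.

Lemma dist_small_eq (x y : X) : (forall eps, 0 < eps -> d x y < eps) -> x = y.
Proof.
  intros H. apply dist_eq0. pose proof (dist_nonneg x y).
  destruct (Req_dec (d x y) 0) as [E|E]; auto. specialize (H (d x y)). lra.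
Qed.

Lemma act_isom (g : G) (x y : X) : d (act g x) (act g y) = d x y.
Proof. apply HX. Qed.

Lemma act_id (x : X) : act Gid x = x.
Proof. now apply HX. Qed.

Lemma act_mul (g h : G) (x : X) : act (Gmul g h) x = act g (act h x).
Proof. now apply HX. Qed.

(** The composition axiom compares maps pointwise, so [g] may be read as the product of [h] and
    [Gid]. *)
Lemma act_ext (g h : G) (x : X) : (forall t, gf g t = gf h t) -> act g x = act h x.
Proof.
  intros E. rewrite <- (act_id x) at 2. now apply HX.
Qed.

Lemma act_invK (g : G) (x : X) : act (Ginv g) (act g x) = x.
Proof.
  rewrite <- act_mul. apply HX. intros t. apply g_left.
Qed.

Lemma act_Kinv (g : G) (x : X) : act g (act (Ginv g) x) = x.
Proof.
  rewrite <- act_mul. apply HX. intros t. apply g_right.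
Qed.

Lemma act_inv_dist (g : G) (x y : X) : d (act (Ginv g) x) y = d x (act g y).
Proof. now rewrite <- (act_isom g), act_Kinv. Qed.

Lemma act_near_id (x : X) (eps : R) :
  0 < eps -> exists delta, 0 < delta /\
    forall h : G, (forall t, Rabs (gf h t - ival t) <= delta) -> d (act h x) x < eps.
Proof.
  intros He.
  assert (C : exists delta, 0 < delta /\ forall h y,
    Gclose h Gid delta -> d y x < delta -> d (act h y) (act Gid x) < eps) by now apply HX.
  destruct C as [dl [Hd H]]. exists dl. split; auto.
  intros h Hh. rewrite <- (act_id x) at 2. apply H; auto. now rewrite dist_refl.
Qed.

Lemma act_pow_dist (g : G) (x : X) (n : nat) : d (act (Gpow g n) x) x <= INR n * d (act g x) x.
Proof.
  induction n as [|n IH]; [simpl; rewrite act_id, dist_refl; lra|].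
  rewrite S_INR. simpl Gpow. rewrite act_mul.
  pose proof (dist_tri (act g (act (Gpow g n) x)) (act g x) x) as T.
  rewrite act_isom in T. lra.
Qed.

(** * Points fixed by all homeomorphisms supported in an interval *)

Definition locally_fixed (p q : R) (x : X) : Prop :=
  forall h : G, supported h p q -> act h x = x.

Lemma locally_fixed_mono (p q p' q' : R) (x : X) :
  p' <= p -> q <= q' -> locally_fixed p' q' x -> locally_fixed p q x.
Proof. intros Hp Hq H h Hh. apply H. eapply supported_mono; eauto. Qed.

(* Conjugating [h] by the power of [g] that shrinks [(p, q)] makes it close to the
   identity, while that power still almost fixes [x]. *)
Lemma locally_fixed_of_push (p q : I) (x : X) :
  p < q ->
  (forall delta, 0 < delta -> exists g, d (act g x) x < delta /\ q <= gf g p) ->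
  locally_fixed p q x.
Proof.
  intros Hpq Hpush h Hh. apply dist_small_eq. intros eps He.
  destruct (act_near_id x (eps / 2)) as [dl [Hd Hnear]]; [lra|].
  destruct (inv_INR_small dl Hd) as [N [HN0 HN]].
  assert (HS : 0 < INR (S N)) by (apply lt_0_INR; lia).
  (* Small enough that the power [k < S N] of [g] still moves [x] by at most [eps / 4]. *)
  destruct (Hpush (eps / 4 * / INR (S N))) as [g [Hg Hgp]].
  { apply Rmult_lt_0_compat; lra. }
  destruct (wandering_interval g p q (S N) Hgp ltac:(lia)) as [k [Hk Hlen]].
  set (gk := Gpow g k) in *.
  (* The conjugate is supported on the image of [(p, q)] under [gk], whose length is below [dl], so
     no point moves farther than that. *)
  assert (Hsmall : d (act (Gmul gk (Gmul h (Ginv gk))) x) x < eps / 2).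
  { apply Hnear. intros t. simpl.
    destruct (classic (p <= ginv gk t <= q)) as [In|Out].
    - pose proof (supported_inside h p q Hh _ In) as In'.
      destruct In as [I1 I2], In' as [J1 J2].
      apply (gf_le gk) in I1, I2, J1, J2. rewrite g_right in I1, I2.
      apply Rabs_le. lra.
    - rewrite Hh by lra. rewrite g_right, Rminus_diag, Rabs_R0. lra. }
  assert (Hgk : d (act gk x) x <= eps / 4).
  { pose proof (act_pow_dist g x k) as P. fold gk in P.
    assert (INR k <= INR (S N)) by (apply le_INR; lia).
    pose proof (dist_nonneg (act g x) x). pose proof (pos_INR k).
    assert (INR (S N) * (eps / 4 * / INR (S N)) = eps / 4) by (field; lra).
    nra. }
  assert (E : act gk (act h x) = act (Gmul gk (Gmul h (Ginv gk))) (act gk x)).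
  { rewrite !act_mul. now rewrite act_invK. }
  (* The distance sought equals that of [h' gk x] and [gk x], bounded by
     [eps / 4 + eps / 2 + eps / 4]. *)
  rewrite <- (act_isom gk), E. set (h' := Gmul gk (Gmul h (Ginv gk))) in *.
  pose proof (dist_tri (act h' (act gk x)) (act h' x) (act gk x)) as T1.
  pose proof (dist_tri (act h' x) x (act gk x)) as T2.
  rewrite act_isom in T1. rewrite (dist_sym x (act gk x)) in T2. lra.
Qed.

(** Here [u] fixes [y] and takes [p, q] to [al, be], while [v] takes these to [a', b'] and moves
    points by at most [dl]. With [w = v u], the point [w^-1 y] is in the ball, hence locally fixed
    on [(p, q)], and [w] carries this back to [y]. The point [m] separates the bumps at the two
    ends. *)
Lemma locally_fixed_expand (y : X) (r dl p q m a b al be a' b' : R) :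
  (forall z, d z y < r -> locally_fixed p q z) ->
  (forall h : G, (forall t, Rabs (gf h t - ival t) <= dl) -> d (act h y) y < r) ->
  0 < a' -> b' < 1 -> 0 < a -> b < 1 -> a < p < m -> m < q < b ->
  a < al < m -> m < be < b -> a' < m < b' ->
  Rabs (a' - al) + Rabs (b' - be) <= dl ->
  locally_fixed a b y -> locally_fixed a' b' y.
Proof.
  intros Hball Hnear Ha' Hb' Ha Hb Hp Hq Hal Hbe Hm Hsmall Hfix.
  destruct (bump_exists a m p al) as [u1 [Su1 [Eu1 _]]]; try lra.
  destruct (bump_exists m b q be) as [u2 [Su2 [Eu2 _]]]; try lra.
  destruct (bump_exists 0 m al a') as [v1 [Sv1 [Ev1 Dv1]]]; try lra.
  destruct (bump_exists m 1 be b') as [v2 [Sv2 [Ev2 Dv2]]]; try lra.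
  set (u := Gmul u1 u2). set (v := Gmul v1 v2). set (w := Gmul v u).
  assert (Hu : act u y = y).
  { apply Hfix, supported_mul; eapply supported_mono; eauto; lra. }
  assert (Hv : d (act v y) y < r).
  { apply Hnear. intros t. simpl.
    pose proof (Dv1 (gf v2 t)). pose proof (Dv2 t).
    replace (gf v1 (gf v2 t) - t) with ((gf v1 (gf v2 t) - gf v2 t) + (gf v2 t - t)) by ring.
    eapply Rle_trans; [apply Rabs_triang|]. lra. }
  assert (Wp : ival (gf w (clamp p)) = a').
  { simpl. rewrite Su2 by (rewrite clampE; lra). rewrite Eu1.
    rewrite Sv2 by (rewrite clampE; lra). rewrite Ev1. apply clampE; lra. }
  assert (Wq : ival (gf w (clamp q)) = b').
  { simpl. rewrite Eu2. rewrite Su1 by (rewrite clampE; lra).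
    rewrite Ev2. rewrite Sv1 by (rewrite clampE; lra). apply clampE; lra. }
  assert (Hz : d (act (Ginv w) y) y < r).
  { rewrite act_inv_dist. unfold w. rewrite act_mul, Hu, dist_sym. exact Hv. }
  intros h Hh.
  assert (Hc : supported (Gmul (Ginv w) (Gmul h w)) p q).
  { pose proof (supported_conj w h (clamp p) (clamp q)) as C.
    rewrite Wp, Wq, !clampE in C by lra. now apply C. }
  pose proof (Hball _ Hz _ Hc) as E. rewrite !act_mul, act_Kinv in E.
  rewrite <- (act_Kinv w (act h y)), E. apply act_Kinv.
Qed.

(** A small correction [k] makes [h1 = k h] fix [tau] and [1 - tau]. Up to a small motion near the
    endpoints, [h1] is then a map supported between these points, which fixes [y]. *)
Lemma locally_fixed_fixed (y : X) :
  (forall tau, 0 < tau < / 2 -> locally_fixed tau (1 - tau) y) -> forall h, act h y = y.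
Proof.
  intros Hfix h. apply dist_small_eq. intros eps He.
  destruct (act_near_id y (eps / 2)) as [dl [Hd Hnear]]; [lra|].
  destruct (g_cont h (clamp 0) (Rmin (dl / 4) (/ 4))) as [e0 [P0 Q0]].
  { apply Rmin_pos; lra. }
  destruct (g_cont h (clamp 1) (Rmin (dl / 4) (/ 4))) as [e1 [P1 Q1]].
  { apply Rmin_pos; lra. }
  rewrite gf_zero in Q0. rewrite gf_one in Q1.
  rewrite (clampE 0) in Q0 by lra. rewrite (clampE 1) in Q1 by lra.
  (* The bound [dl / 4] leaves room for two bumps in [k]; the bound 1/4 keeps their supports in
     different halves. *)
  set (c := Rmin (dl / 4) (/ 4)) in *.
  assert (Hc : 0 < c) by (apply Rmin_pos; lra).
  assert (Hc1 : c <= dl / 4) by apply Rmin_l. assert (Hc2 : c <= / 4) by apply Rmin_r.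
  set (tau := Rmin c (Rmin e0 e1) / 2).
  assert (Ht : 0 < tau /\ tau < c /\ tau < e0 /\ tau < e1).
  { assert (0 < Rmin c (Rmin e0 e1)) 
      by (apply Rmin_pos; [exact Hc|now apply Rmin_pos]).
    pose proof (Rmin_l c (Rmin e0 e1)). pose proof (Rmin_r c (Rmin e0 e1)).
    pose proof (Rmin_l e0 e1). pose proof (Rmin_r e0 e1). unfold tau. lra. }
  destruct Ht as [T0 [T1 [T2 T3]]].
  set (s := clamp tau). set (s' := clamp (1 - tau)).
  assert (Es : ival s = tau) by (apply clampE; lra).
  assert (Es' : ival s' = 1 - tau) by (apply clampE; lra).
  assert (Hs : 0 < gf h s < c).
  { split.
    - rewrite <- (clampE 0), <- (gf_zero h) by lra. apply g_incr. rewrite clampE by lra. lra.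
    - specialize (Q0 s). rewrite Es, Rabs_pos_eq in Q0 by lra.
      specialize (Q0 ltac:(lra)). apply Rabs_def2 in Q0. lra. }
  assert (Hs' : 1 - c < gf h s' < 1).
  { split.
    - specialize (Q1 s'). rewrite Es', Rabs_left in Q1 by lra.
      specialize (Q1 ltac:(lra)). apply Rabs_def2 in Q1. lra.
    - rewrite <- (clampE 1), <- (gf_one h) by lra. apply g_incr. rewrite clampE by lra. lra. }
  destruct (bump_exists 0 (/ 2) (gf h s) tau) as [k1 [S1 [E1 D1]]]; try lra.
  destruct (bump_exists (/ 2) 1 (gf h s') (1 - tau)) as [k2 [S2 [E2 D2]]]; try lra.
  rewrite clamp_ival in E1, E2.
  set (k := Gmul k1 k2). set (h1 := Gmul k h).
  assert (H1s : gf h1 s = s).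
  { simpl. rewrite S2 by lra. exact E1. }
  assert (H1s' : gf h1 s' = s').
  { simpl. rewrite E2. apply S1. fold s'. lra. }
  destruct (restriction_exists h1 s s') as [h2 [Sh2 Eh2]]; auto; [lra|].
  assert (F2 : act h2 y = y).
  { apply (Hfix tau); [lra|]. now rewrite <- Es', <- Es. }
  assert (N1 : d (act h1 y) y < eps / 2).
  { rewrite <- F2 at 2. rewrite <- (act_isom (Ginv h2)), act_invK, <- act_mul.
    apply Hnear. intros t.
    destruct (classic (s <= t <= s')) as [In|Out].
    - change (gf (Gmul (Ginv h2) h1) t) with (ginv h2 (gf h1 t)).
      rewrite <- (Eh2 t In), g_left, Rminus_diag, Rabs_R0. lra.
    - change (gf (Gmul (Ginv h2) h1) t) with (ginv h2 (gf h1 t)).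
      assert (O : (gf h1 t < s /\ t < s) \/ (s' < gf h1 t /\ s' < t)).
      { destruct (Rlt_le_dec t s) as [L|L].
        - left. split; auto. apply (g_incr h1) in L. now rewrite H1s in L.
        - assert (L' : s' < t) by lra.
          right. split; auto. apply (g_incr h1) in L'. now rewrite H1s' in L'. }
      rewrite <- (Sh2 (gf h1 t)) by lra. rewrite g_left.
      pose proof (ival_bounds t). pose proof (ival_bounds (gf h1 t)).
      apply Rabs_le. lra. }
  assert (N2 : d (act k y) y < eps / 2).
  { apply Hnear. intros t. simpl.
    pose proof (D1 (gf k2 t)) as B1. pose proof (D2 t) as B2.
    assert (C1 : Rabs (tau - gf h s) <= c) by (apply Rabs_le; lra).
    assert (C2 : Rabs (1 - tau - gf h s') <= c) by (apply Rabs_le; lra).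
    replace (gf k1 (gf k2 t) - t) with ((gf k1 (gf k2 t) - gf k2 t) + (gf k2 t - t)) by ring.
    eapply Rle_trans; [apply Rabs_triang|]. lra. }
  rewrite <- (act_isom k), <- act_mul. fold h1.
  pose proof (dist_tri (act h1 y) y (act k y)) as T. rewrite (dist_sym y) in T. lra.
Qed.

Lemma locally_fixed_nowhere_dense (p q r : R) (y : X) :
  minimal d act -> (exists x z : X, x <> z) -> 0 < p -> p < q -> q < 1 -> 0 < r ->
  exists z, d z y < r /\ ~ locally_fixed p q z.
Proof.
  intros Hmin [x0 [x1 Hne]] Hp Hpq Hq Hr. apply NNPP. intros Hno.
  assert (Hball : forall z, d z y < r -> locally_fixed p q z).
  { intros z Hz. apply NNPP. intros Hz'. apply Hno. eauto. }
  destruct (act_near_id y r Hr) as [dl [Hd Hnear]].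
  set (m := (p + q) / 2).
  (* The two endpoints are pushed by at most [2 ka] each, in total at most [dl]; the other bound
     keeps [al] and [be] on their sides of [m]. *)
  set (ka := Rmin (dl / 4) ((q - p) / 4)).
  assert (K1 : ka <= dl / 4) by apply Rmin_l.
  assert (K2 : ka <= (q - p) / 4) by apply Rmin_r.
  assert (K0 : 0 < ka) by (apply Rmin_pos; lra).
  (* Each expansion multiplies the gaps to 0 and to 1 by [1 - ka], so the intervals exhaust
     [(0, 1)]. *)
  assert (Hn : forall n, locally_fixed (p * (1 - ka) ^ n) (1 - (1 - q) * (1 - ka) ^ n) y).
  { induction n as [|n IH].
    - simpl. replace (p * 1) with p by ring. replace (1 - (1 - q) * 1) with q by ring.
      apply Hball. now rewrite dist_refl.
    - assert (L0 : 0 < (1 - ka) ^ n) by (apply pow_lt; lra).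
      assert (L1 : (1 - ka) ^ n <= 1).
      { pose proof (pow_incr (1 - ka) 1 n) as P. rewrite pow1 in P. apply P; lra. }
      simpl pow. set (l := (1 - ka) ^ n) in *.
      assert (HA : 0 < p * l <= p) by (split; nra).
      assert (HB : 0 < (1 - q) * l <= 1 - q) by (split; nra).
      replace (p * ((1 - ka) * l)) with ((1 - ka) * (p * l)) by ring.
      replace ((1 - q) * ((1 - ka) * l)) with ((1 - ka) * ((1 - q) * l)) by ring.
      set (A := p * l) in *. set (B := (1 - q) * l) in *.
      assert (KA : 0 < ka * A <= ka /\ ka * A < A) by (repeat split; nra).
      assert (KB : 0 < ka * B <= ka /\ ka * B < B) by (repeat split; nra).
      (* The ball's interval is shrunk to half its length, so that it lies strictly inside
         [(A, 1 - B)] even for [n = 0]. *)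
      apply (locally_fixed_expand y r dl ((p + m) / 2) ((q + m) / 2) m
               A (1 - B) (A + ka * A) (1 - B - ka * B)); try exact IH; try exact Hnear;
        unfold m; try lra.
      + intros z Hz. eapply locally_fixed_mono; [| |apply (Hball z Hz)]; lra.
      + rewrite Rabs_left, Rabs_pos_eq by lra. lra. }
  assert (Hfix : forall h, act h y = y).
  { apply locally_fixed_fixed. intros tau Ht.
    destruct (pow_lt_1_zero (1 - ka)) with (y := tau) as [n Hpow];
      [rewrite Rabs_pos_eq; lra | lra |].
    specialize (Hpow n (le_n n)). apply Rabs_def2 in Hpow.
    assert (L0 : 0 < (1 - ka) ^ n) by (apply pow_lt; lra).
    eapply locally_fixed_mono; [| |apply (Hn n)]; nra. }
  assert (Hall : forall z, z = y).
  { intros z. apply dist_small_eq. intros eps He.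
    destruct (Hmin y z eps He) as [g Hg]. rewrite Hfix in Hg. now rewrite dist_sym. }
  apply Hne. now rewrite (Hall x0), (Hall x1).
Qed.

(** If [h] fixes [z], it moves [x] by at most twice the distance to [z]. So half the displacement of
    [x] is a suitable radius. *)
Lemma not_locally_fixed_open (p q : R) (x : X) :
  ~ locally_fixed p q x ->
  exists r, 0 < r /\ forall z, d z x < r -> ~ locally_fixed p q z.
Proof.
  intros Hx. apply not_all_ex_not in Hx. destruct Hx as [h Hh].
  apply imply_to_and in Hh. destruct Hh as [Hs Hm].
  pose proof (dist_nonneg (act h x) x).
  assert (Hpos : d (act h x) x <> 0) by (intros E; now apply Hm, dist_eq0).
  exists (d (act h x) x / 2). split; [lra|].
  intros z Hz Hf. specialize (Hf h Hs).
  pose proof (dist_tri (act h x) (act h z) x) as T. rewrite act_isom, Hf in T.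
  rewrite (dist_sym x z) in T. lra.
Qed.

Lemma generic_point :
  minimal d act -> (exists x z : X, x <> z) ->
  exists x, forall p q, 0 <= p -> p < q -> q <= 1 -> ~ locally_fixed p q x.
Proof.
  intros Hmin Hne.
  (* One open dense condition for each pair [(i, j)]; it is vacuous for intervals reaching 1 or
     beyond. *)
  destruct (baire d (fun n x => let (i, j) := Cantor.of_nat n in
    INR (S (S i)) / INR (S j) < 1 ->
    ~ locally_fixed (INR (S i) / INR (S j)) (INR (S (S i)) / INR (S j)) x)) as [x Hx];
    try apply HX.
  - intros n x. destruct (Cantor.of_nat n) as [i j]. intros H.
    destruct (Rlt_le_dec (INR (S (S i)) / INR (S j)) 1) as [L|L].
    + destruct (not_locally_fixed_open _ _ _ (H L)) as [r [Hr Hz]]. eauto.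
    + exists 1. split; [lra|]. intros; lra.
  - intros n y r Hr. destruct (Cantor.of_nat n) as [i j].
    destruct (Rlt_le_dec (INR (S (S i)) / INR (S j)) 1) as [L|L].
    + assert (0 < INR (S j)) by (apply lt_0_INR; lia).
      assert (0 < INR (S i)) by (apply lt_0_INR; lia).
      destruct (locally_fixed_nowhere_dense (INR (S i) / INR (S j))
        (INR (S (S i)) / INR (S j)) r y) as [z [Hz Hf]]; auto.
      * now apply Rdiv_lt_0_compat.
      * apply Rmult_lt_compat_r; [now apply Rinv_0_lt_compat|]. rewrite (S_INR (S i)). lra.
      * eauto.
    + exists y. rewrite dist_refl. split; auto. intros; lra.
  - exists x. intros p q Hp Hpq Hq Hf.
    destruct (rational_between p q Hp Hpq) as [i [j [H1 H2]]].
    specialize (Hx (Cantor.to_nat (i, j))). rewrite Cantor.cancel_of_to in Hx.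
    apply Hx; [lra|]. eapply locally_fixed_mono; [| |exact Hf]; lra.
Qed.

(** * The orbit map, its inverse and their extension to monotone surjections *)

Definition separated_at (x : X) : Prop :=
  forall eps, 0 < eps -> exists delta, 0 < delta /\
    forall g, d (act g x) x < delta -> forall t, Rabs (gf g t - ival t) <= eps.

(** By [locally_fixed_of_push], for each [p < q] some threshold on [d (act g x) x] forces [g p < q].
    Finitely many thresholds, on a grid of spacing [e], control [g] uniformly. *)
Lemma generic_point_separated (x : X) :
  (forall p q, 0 <= p -> p < q -> q <= 1 -> ~ locally_fixed p q x) ->
  separated_at x.
Proof.
  intros Hx eps He.
  assert (Hpt : forall p q : I, p < q -> exists delta, 0 < delta /\
    forall g, d (act g x) x < delta -> gf g p < q).
  { intros p q Hpq. apply NNPP. intros Hno.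
    pose proof (ival_bounds p). pose proof (ival_bounds q).
    apply (Hx p q); try lra. apply locally_fixed_of_push; auto.
    intros dl Hd. apply NNPP. intros Hno'. apply Hno. exists dl. split; auto.
    intros g Hg. apply Rnot_le_lt. intros L. apply Hno'. eauto. }
  destruct (inv_INR_small (eps / 2)) as [N [N0 N1]]; [lra|].
  set (e := / INR (S N)) in *.
  assert (HS : 0 < INR (S N)) by (apply lt_0_INR; lia).
  assert (Ee : INR (S N) * e = 1) by (unfold e; field; lra).
  assert (Hgrid : forall n, (n <= S N)%nat -> exists delta, 0 < delta /\
    forall g, d (act g x) x < delta ->
      forall k, (k < n)%nat -> gf g (clamp (INR k * e)) < INR (S k) * e).
  { induction n as [|n IH]; intros Hn.
    - exists 1. split; [lra|]. intros; lia.
    - destruct IH as [d1 [P1 Q1]]; [lia|].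
      assert (B0 : 0 <= INR n * e) by (apply Rmult_le_pos; [apply pos_INR|lra]).
      assert (B1 : INR n * e < INR (S n) * e) by (rewrite S_INR; nra).
      assert (B2 : INR (S n) * e <= 1).
      { rewrite <- Ee. apply Rmult_le_compat_r; [lra|]. now apply le_INR. }
      destruct (Hpt (clamp (INR n * e)) (clamp (INR (S n) * e))) as [d2 [P2 Q2]].
      { rewrite !clampE by lra. lra. }
      rewrite (clampE (INR (S n) * e)) in Q2 by lra.
      exists (Rmin d1 d2). split; [now apply Rmin_pos|]. intros g Hg k Hk.
      pose proof (Rmin_l d1 d2). pose proof (Rmin_r d1 d2).
      destruct (Nat.eq_dec k n) as [->|Hkn].
      + apply Q2. lra.
      + apply Q1; [lra|lia]. }
  (* For [t] in the [k]-th cell, [g t <= g ((k+1) e) < (k+2) e <= t + 2 e]; in the last cell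
     [g t <= 1] suffices. *)
  destruct (Hgrid (S N) (le_n _)) as [dl [Hd Hdl]].
  assert (Hup : forall g, d (act g x) x < dl -> forall t : I, gf g t <= t + eps).
  { intros g Hg t. pose proof (ival_bounds t).
    destruct (nat_floor (t * INR (S N))) as [k [K0 K1]]; [nra|].
    assert (T0 : INR k * e <= t).
    { replace (ival t) with (t * INR (S N) * e) by (rewrite Rmult_assoc, Ee; ring).
      apply Rmult_le_compat_r; lra. }
    assert (T1 : t <= INR (S k) * e).
    { replace (ival t) with (t * INR (S N) * e) by (rewrite Rmult_assoc, Ee; ring).
      rewrite (S_INR k). apply Rmult_le_compat_r; lra. }
    rewrite S_INR in T1.
    destruct (Nat.lt_ge_cases (S k) (S N)) as [L|L].
    - specialize (Hdl g Hg (S k) L). rewrite !S_INR in Hdl.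
      assert (B2 : INR (S k) * e <= 1).
      { rewrite <- Ee. apply Rmult_le_compat_r; [lra|]. apply le_INR; lia. }
      rewrite S_INR in B2.
      assert (gf g t <= gf g (clamp ((INR k + 1) * e))).
      { apply gf_le. rewrite clampE; lra. }
      lra.
    - pose proof (ival_bounds (gf g t)).
      assert (1 <= INR (S k) * e).
      { rewrite <- Ee. apply Rmult_le_compat_r; [lra|]. now apply le_INR. }
      rewrite S_INR in *. lra. }
  exists dl. split; auto. intros g Hg t. apply Rabs_le.
  (* The inverse moves [x] equally far, so the upper bound for it gives the lower bound for [g]. *)
  assert (Hg' : d (act (Ginv g) x) x < dl) by (now rewrite act_inv_dist, dist_sym).
  pose proof (Hup g Hg t). pose proof (Hup _ Hg' (gf g t)) as H'.
  simpl in H'. rewrite g_left in H'. lra.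
Qed.

(** Inverses appear because the uniform distance on [G] is right invariant: [g h^-1] is as close to
    the identity as [g] is to [h]. *)
Lemma orbit_unif_cont (x : X) (eps : R) :
  0 < eps -> exists delta, 0 < delta /\ forall g h,
    Gclose g h delta -> d (act (Ginv g) x) (act (Ginv h) x) < eps.
Proof.
  intros He. destruct (act_near_id x eps He) as [dl [Hd H]].
  exists dl. split; auto. intros g h Hgh.
  rewrite act_inv_dist, <- act_mul, dist_sym. apply H. intros t. simpl.
  specialize (Hgh (ginv h t)). now rewrite g_right in Hgh.
Qed.

Lemma orbit_inv_unif_cont (x : X) (eps : R) :
  separated_at x -> 0 < eps -> exists delta, 0 < delta /\ forall g h,
    d (act (Ginv g) x) (act (Ginv h) x) < delta -> Gclose g h eps.
Proof.
  intros Hx He. destruct (Hx eps He) as [dl [Hd H]].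
  exists dl. split; auto. intros g h Hgh t.
  rewrite act_inv_dist, <- act_mul, dist_sym in Hgh.
  specialize (H _ Hgh (gf h t)). simpl in H. now rewrite g_left in H.
Qed.

(* The graph of the homeomorphism: the closure of the pairs [(g, g^-1 x)] in [M * X]. *)
Definition limit_pair (x : X) (a : M) (y : X) : Prop :=
  forall eps, 0 < eps -> exists g : G,
    (forall t, Rabs (gf g t - xi a t) <= eps) /\ d (act (Ginv g) x) y < eps.

(** Replacing both pairs by nearby orbit pairs reduces this to [orbit_unif_cont]. For [a = b] it
    shows that [y] is determined by [a]. *)
Lemma limit_pair_unif_cont (x : X) (eps : R) :
  0 < eps -> exists delta, 0 < delta /\ forall a b y z,
    limit_pair x a y -> limit_pair x b z -> Mclose a b delta -> d y z < eps.
Proof.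
  intros He. destruct (orbit_unif_cont x (eps / 3)) as [dl [Hd H]]; [lra|].
  exists (dl / 3). split; [lra|]. intros a b y z Ha Hb Hab.
  set (e := Rmin (dl / 3) (eps / 3)).
  assert (E0 : 0 < e) by (apply Rmin_pos; lra).
  assert (E1 : e <= dl / 3) by apply Rmin_l. assert (E2 : e <= eps / 3) by apply Rmin_r.
  destruct (Ha e E0) as [g [Ga Gy]], (Hb e E0) as [h [Hhb Hz]].
  assert (Hgh : Gclose g h dl).
  { intros t. specialize (Ga t). specialize (Hhb t). specialize (Hab t).
    apply Rabs_le. apply Rabs_le_inv in Ga, Hhb, Hab. lra. }
  apply H in Hgh.
  pose proof (dist_tri y (act (Ginv g) x) z) as T1.
  pose proof (dist_tri (act (Ginv g) x) (act (Ginv h) x) z) as T2.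
  rewrite (dist_sym y (act _ _)) in T1. lra.
Qed.

(** The same reduction for the inverse; for [y = z] it gives injectivity. *)
Lemma limit_pair_inv_unif_cont (x : X) (eps : R) :
  separated_at x -> 0 < eps -> exists delta, 0 < delta /\ forall a b y z,
    limit_pair x a y -> limit_pair x b z -> d y z < delta -> Mclose a b eps.
Proof.
  intros Hx He. destruct (orbit_inv_unif_cont x (eps / 3) Hx) as [dl [Hd H]]; [lra|].
  exists (dl / 3). split; [lra|]. intros a b y z Ha Hb Hyz.
  set (e := Rmin (dl / 3) (eps / 3)).
  assert (E0 : 0 < e) by (apply Rmin_pos; lra).
  assert (E1 : e <= dl / 3) by apply Rmin_l. assert (E2 : e <= eps / 3) by apply Rmin_r.
  destruct (Ha e E0) as [g [Ga Gy]], (Hb e E0) as [h [Hhb Hz]].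
  assert (Hgh : Gclose g h (eps / 3)).
  { apply H. pose proof (dist_tri (act (Ginv g) x) y (act (Ginv h) x)) as T1.
    pose proof (dist_tri y z (act (Ginv h) x)) as T2.
    rewrite (dist_sym z) in T2. lra. }
  intros t. specialize (Ga t). specialize (Hhb t). specialize (Hgh t).
  apply Rabs_le. apply Rabs_le_inv in Ga, Hhb, Hgh. lra.
Qed.

(** If [g] approximates [a], then [g h^-1] approximates [b] equally well, and its orbit point is
    [h g^-1 x]. *)
Lemma limit_pair_equivariant (x : X) (h : G) (a b : M) (y : X) :
  Mact_rel h a b -> limit_pair x a y -> limit_pair x b (act h y).
Proof.
  intros Hab Ha eps He. destruct (Ha eps He) as [g [Hg Hy]].
  exists (Gmul g (Ginv h)). split.
  - intros t. rewrite Hab. apply Hg.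
  - rewrite (act_ext _ (Gmul h (Ginv g))) by reflexivity.
    now rewrite act_mul, act_isom.
Qed.

(** Homeomorphisms converging to [a] have a Cauchy sequence of orbit points, and [X] is complete. *)
Lemma limit_pair_total (x : X) (a : M) : exists y, limit_pair x a y.
Proof.
  destruct (choice (fun n (g : G) => forall t, Rabs (gf g t - xi a t) <= / INR (S n)))
    as [u Hu].
  { intros n. apply G_dense_M, Rinv_0_lt_compat, lt_0_INR. lia. }
  assert (Happ : forall eps, 0 < eps -> exists N, forall n, (N <= n)%nat ->
     forall t, Rabs (gf (u n) t - xi a t) <= eps).
  { intros eps He. destruct (inv_INR_small eps He) as [N [_ HN]].
    exists N. intros n Hn t. eapply Rle_trans; [apply Hu|].
    assert (/ INR (S n) <= / INR (S N)); [|lra].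
    apply Rinv_le_contravar; [apply lt_0_INR; lia|apply le_INR; lia]. }
  assert (Hcomp : complete d) by apply HX.
  destruct (Hcomp (fun n => act (Ginv (u n)) x)) as [y Hy].
  - intros eps He. destruct (orbit_unif_cont x eps He) as [dl [Hd H]].
    destruct (Happ (dl / 2)) as [N HN]; [lra|]. exists N. intros m n Hm Hn. apply H.
    intros t. pose proof (HN m Hm t) as Bm. pose proof (HN n Hn t) as Bn.
    apply Rabs_le_inv in Bm, Bn. apply Rabs_le. lra.
  - exists y. intros eps He. destruct (Happ eps He) as [N1 H1], (Hy eps He) as [N2 H2].
    exists (u (N1 + N2)%nat). split; [apply H1|apply H2]; lia.
Qed.

(** Minimality gives orbit points converging to [y]; by separation their homeomorphisms are
    uniformly Cauchy. *)
Lemma limit_pair_surj (x : X) (y : X) :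
  minimal d act -> separated_at x -> exists a, limit_pair x a y.
Proof.
  intros Hmin Hx.
  destruct (choice (fun n (g : G) => d (act (Ginv g) x) y < / INR (S n))) as [u Hu].
  { intros n. destruct (Hmin x y (/ INR (S n))) as [g Hg].
    - apply Rinv_0_lt_compat, lt_0_INR. lia.
    - exists (Ginv g). rewrite (act_ext _ g); auto. }
  assert (Happ : forall eps, 0 < eps -> exists N, forall n, (N <= n)%nat ->
     d (act (Ginv (u n)) x) y < eps).
  { intros eps He. destruct (inv_INR_small eps He) as [N [_ HN]].
    exists N. intros n Hn. eapply Rlt_le_trans; [apply Hu|].
    assert (/ INR (S n) <= / INR (S N)); [|lra].
    apply Rinv_le_contravar; [apply lt_0_INR; lia|apply le_INR; lia]. }
  destruct (M_complete u) as [a Ha].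
  - intros eps He. destruct (orbit_inv_unif_cont x eps Hx He) as [dl [Hd H]].
    destruct (Happ (dl / 2)) as [N HN]; [lra|]. exists N. intros m n Hm Hn. apply H.
    pose proof (HN m Hm). pose proof (HN n Hn).
    pose proof (dist_tri (act (Ginv (u m)) x) y (act (Ginv (u n)) x)) as T.
    rewrite (dist_sym y) in T. lra.
  - exists a. intros eps He. destruct (Ha eps He) as [N1 H1], (Happ eps He) as [N2 H2].
    exists (u (N1 + N2)%nat). split; [apply H1|apply H2]; lia.
Qed.

(** Both maps are chosen inside the relation [limit_pair] for a generic [x]. It is one-to-one, so
    they are mutually inverse. *)
Lemma minimal_space_is_M :
  minimal d act -> (exists x y : X, x <> y) ->
  exists (f : M -> X) (finv : X -> M),
    (forall a, finv (f a) = a) /\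
    (forall x, f (finv x) = x) /\
    (forall g a b, Mact_rel g a b -> f b = act g (f a)) /\
    (forall eps, 0 < eps -> exists delta, 0 < delta /\
       forall a b, Mclose a b delta -> d (f a) (f b) < eps) /\
    (forall eps, 0 < eps -> exists delta, 0 < delta /\
       forall x y, d x y < delta -> Mclose (finv x) (finv y) eps).
Proof.
  intros Hmin Hne. destruct (generic_point Hmin Hne) as [x Hgen].
  pose proof (generic_point_separated x Hgen) as Hx.
  destruct (choice _ (limit_pair_total x)) as [f Hf].
  destruct (choice (fun y a => limit_pair x a y)) as [k Hk].
  { intros y. now apply limit_pair_surj. }
  assert (Hfun : forall a y z, limit_pair x a y -> limit_pair x a z -> y = z).
  { intros a y z Hy Hz. apply dist_small_eq. intros eps He.
    destruct (limit_pair_unif_cont x eps He) as [dl [Hd H]].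
    apply (H a a); auto. intros t. rewrite Rminus_diag, Rabs_R0. lra. }
  assert (Hinj : forall a b y, limit_pair x a y -> limit_pair x b y -> a = b).
  { intros a b y Ha Hb. apply M_ext. intros t. apply ival_inj.
    apply Rle_antisym; apply Rle_plus_epsilon; intros eps He;
      destruct (limit_pair_inv_unif_cont x eps Hx He) as [dl [Hd H]];
      assert (C : Mclose a b eps) by (apply (H a b y y); auto; now rewrite dist_refl);
      specialize (C t); apply Rabs_le_inv in C; lra. }
  exists f, k. split; [|split; [|split; [|split]]].
  - intros a. eapply Hinj; [apply Hk|apply Hf].
  - intros y. eapply Hfun; [apply Hf|apply Hk].
  - intros g a b Hab. eapply Hfun; [apply Hf|]. eapply limit_pair_equivariant; eauto.
  - intros eps He. destruct (limit_pair_unif_cont x eps He) as [dl [Hd H]].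
    exists dl. split; auto. intros a b. apply H; auto.
  - intros eps He. destruct (limit_pair_inv_unif_cont x eps Hx He) as [dl [Hd H]].
    exists dl. split; auto. intros y z. apply H; auto.
Qed.

(** * Transitive spaces *)

Lemma transitive_minimal : transitive act -> minimal d act.
Proof.
  intros Ht x y eps He. destruct (Ht x y) as [g Hg]. exists g. now rewrite Hg, dist_refl.
Qed.

End Action.

Theorem theorem3p7 :
  (forall (X : Type) (d : X -> X -> R) (act : G -> X -> X),
     G_space d act -> minimal d act -> (exists x y : X, x <> y) ->
     exists (f : M -> X) (finv : X -> M),
       (forall a, finv (f a) = a) /\
       (forall x, f (finv x) = x) /\
       (forall g a b, Mact_rel g a b -> f b = act g (f a)) /\
       (forall eps, 0 < eps -> exists delta, 0 < delta /\
          forall a b, Mclose a b delta -> d (f a) (f b) < eps) /\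
       (forall eps, 0 < eps -> exists delta, 0 < delta /\
          forall x y, d x y < delta -> Mclose (finv x) (finv y) eps)) /\
  (forall (X : Type) (d : X -> X -> R) (act : G -> X -> X),
     G_space d act -> transitive act -> forall x y : X, x = y).
Proof.
  split.
  - intros X d act HX. exact (minimal_space_is_M HX).
  - intros X d act HX Htr x y. apply NNPP. intros Hxy.
    destruct (minimal_space_is_M HX (transitive_minimal HX Htr)) as
      [f [k [Hkf [_ [Heq _]]]]]; [eauto|].
    destruct noninjective_M as [a [s [t [Hst E]]]].
    (* Transitivity carried over to [M] puts the noninjective [a] in the orbit of the identity map,
       whose members are injective. *)
    destruct (Htr (f (M_of_G Gid)) (f a)) as [g Hg].
    assert (Ea : M_of_G (Ginv g) = a).
    { rewrite <- (Hkf a), <- Hg, <- (Heq g (M_of_G Gid) (M_of_G (Ginv g))).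
      - now rewrite Hkf.
      - intros u. reflexivity. }
    subst a. simpl in E. apply Hst. rewrite <- (g_right g s), E. apply g_right.
Qed.
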